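(* The relaxation step of the two-dimensional nine-velocity cascaded Geier scheme (as defined in the context) is diagonal in the basis of moments given by the polynomials $Q_0,\dots,Q_8$ equal, in order, to $$1,\;X,\;Y,\;X^2+Y^2,\;X^2-Y^2,\;XY,\;XY^2,\;X^2Y,\;X^2Y^2,$$ shifted with respect to the fluid velocity $u$. That is: let $N(u)\in\mathbb{R}^{9\times 9}$ have entries $N_{kj}(u)=Q_k(v_j-u)$, where $u=(q^1,q^2)/\rho$, $\rho=\sum_j f_j\neq 0$, $q^\alpha=\sum_j v_j^\alpha f_j$. Then there is a diagonal matrix $D$, depending only on the relaxation parameters, such that the post-collision distribution $f^\star$ of the cascaded scheme satisfies $$N(u)f^\star=N(u)f+D\,\big(N(u)f^{\rm eq}-N(u)f\big).$$ Hence the cascaded scheme is a lattice Boltzmann scheme with relative velocities, with velocity field $\widetilde u=u$.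
   Context: Let $\lambda>0$ and let the velocities be $(v_0,\dots,v_8)=((0,0),(\lambda,0),(0,\lambda),(-\lambda,0),(0,-\lambda),(\lambda,\lambda),(-\lambda,\lambda),(-\lambda,-\lambda),(\lambda,-\lambda))$. Components of vectors and matrices are indexed from $0$ to $8$. **Scheme with relative velocities.** Given nine polynomials $P_k$ and a velocity field $\widetilde u$, let $M(\widetilde u)_{kj}=P_k(v_j-\widetilde u)$. The relaxation maps $f$ to $f^\star$ where, with $m=M(\widetilde u)f$, $m^{\rm eq}=M(\widetilde u)f^{\rm eq}$, $m^\star=M(\widetilde u)f^\star$, one has $m^\star_k=m_k+s_k(m^{\rm eq}_k-m_k)$ for every $k$ (diagonal relaxation). **Cascaded Geier relaxation.** Let $M(0)\in\mathbb{R}^{9\times9}$ be the matrix with entries $P_k(v_j)$, where $P_0,\dots,P_8$ are, in order, $1$, $X$, $Y$, $\tfrac{1}{\lambda^2}(3(X^2+Y^2)-4\lambda^2)$, $\tfrac{1}{\lambda^2}(X^2-Y^2)$, $\tfrac{1}{\lambda^2}XY$, $\tfrac{1}{\lambda^3}X(3(X^2+Y^2)-5\lambda^2)$, $\tfrac{1}{\lambda^3}Y(3(X^2+Y^2)-5\lambda^2)$, $\tfrac{1}{\lambda^4}(\tfrac92(X^2+Y^2)^2-\tfrac{21\lambda^2}{2}(X^2+Y^2)+4\lambda^4)$. Let $M_g(u)\in\mathbb{R}^{9\times 9}$ be the matrix with entries $R_k(v_j-u)$, where $R_0,\dots,R_8$ are, in order, $1,X,Y,X^2,Y^2,XY,XY^2,X^2Y,X^2Y^2$,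 and $u=q/\rho$ is the fluid velocity. Let $f\in\mathbb{R}^9$ be the pre-collision distribution and $f^{\rm eq}\in\mathbb{R}^9$ the equilibrium distribution, which has the same $\rho,q^1,q^2$ as $f$; put $m_g=M_g(u)f$ and $m_g^{\rm eq}=M_g(u)f^{\rm eq}$. Let $s_3,\dots,s_8$ be nonzero relaxation parameters. The post-collision distribution is $$f^\star=f+{}^tM(0)\, g,$$ where, with $C=M_g(u)\,{}^tM(0)$, the vector $g=(g_0,\dots,g_8)$ is determined successively by: - $g_0=g_1=g_2=0$ (mass and momentum are conserved); - $\begin{pmatrix} (m_g^{\rm eq}-m_g)_3 \\ (m_g^{\rm eq}-m_g)_4 \end{pmatrix}=\begin{pmatrix} C_{33} & C_{34} \\ C_{43} & C_{44} \end{pmatrix}\begin{pmatrix} 1/s_3 & 0 \\ 0 & 1/s_4 \end{pmatrix}\begin{pmatrix} g_3 \\ g_4 \end{pmatrix}$; - for $k=5,6,7,8$ in this order, $s_k(m_g^{\rm eq}-m_g)_k=\sum_{j=1}^{k}C_{kj}\, g_j$. *)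

(* Defs.v *)
From mathcomp Require Import all_boot all_order all_algebra.
From mathcomp Require Import reals.

Set Implicit Arguments.
Unset Strict Implicit.
Unset Printing Implicit Defensive.

Import Order.TTheory GRing.Theory Num.Theory.
Local Open Scope ring_scope.

Notation ix k := (@Ordinal 9 k isT) (only parsing).

(* Distributions are column vectors 'cV[R]_9; velocities are pairs R * R, with
   the product Z-module structure, so that v - w is componentwise.            *)

Definition velocity (R : realType) (lam : R) (j : 'I_9) : R * R :=
  nth (0, 0)
    [:: (0, 0); (lam, 0); (0, lam); (- lam, 0); (0, - lam);
        (lam, lam); (- lam, lam); (- lam, - lam); (lam, - lam)] j.

Definition density (R : realType) (f : 'cV[R]_9) : R := \sum_j f j 0.

Definition momentum (R : realType) (lam : R) (f : 'cV[R]_9) : R * R :=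
  (\sum_j (velocity lam j).1 * f j 0, \sum_j (velocity lam j).2 * f j 0).

Definition fluid_velocity (R : realType) (lam : R) (f : 'cV[R]_9) : R * R :=
  ((momentum lam f).1 / density f, (momentum lam f).2 / density f).

(* Polynomials in X and Y are bivariate polynomials in the sense of polyXY:
   'X is the outer variable, 'Y = 'X%:P the inner one, real constants c are
   c%:P%:P, and p.[x, y] is evaluation at X = x, Y = y.                       *)
Definition moment_matrix (R : realType) (lam : R)
    (P : 'I_9 -> {poly {poly R}}) (w : R * R) : 'M[R]_9 :=
  \matrix_(k, j) (P k).[(velocity lam j - w).1, (velocity lam j - w).2].

Definition poly_P (R : realType) (lam : R) (k : 'I_9) : {poly {poly R}} :=
  nth 0
    [:: 1;
        'X;
        'Y;
        (lam ^- 2)%:P%:P * (3 * ('X ^+ 2 + 'Y ^+ 2) - (4 * lam ^+ 2)%:P%:P);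
        (lam ^- 2)%:P%:P * ('X ^+ 2 - 'Y ^+ 2);
        (lam ^- 2)%:P%:P * ('X * 'Y);
        (lam ^- 3)%:P%:P * 'X
          * (3 * ('X ^+ 2 + 'Y ^+ 2) - (5 * lam ^+ 2)%:P%:P);
        (lam ^- 3)%:P%:P * 'Y
          * (3 * ('X ^+ 2 + 'Y ^+ 2) - (5 * lam ^+ 2)%:P%:P);
        (lam ^- 4)%:P%:P
          * ((9 / 2)%:P%:P * ('X ^+ 2 + 'Y ^+ 2) ^+ 2
             - (21 * lam ^+ 2 / 2)%:P%:P * ('X ^+ 2 + 'Y ^+ 2)
             + (4 * lam ^+ 4)%:P%:P)] k.

Definition poly_R (R : realType) (k : 'I_9) : {poly {poly R}} :=
  nth 0
    [:: 1; 'X; 'Y; 'X ^+ 2; 'Y ^+ 2; 'X * 'Y;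
        'X * 'Y ^+ 2; 'X ^+ 2 * 'Y; 'X ^+ 2 * 'Y ^+ 2] k.

Definition poly_Q (R : realType) (k : 'I_9) : {poly {poly R}} :=
  nth 0
    [:: 1; 'X; 'Y; 'X ^+ 2 + 'Y ^+ 2; 'X ^+ 2 - 'Y ^+ 2; 'X * 'Y;
        'X * 'Y ^+ 2; 'X ^+ 2 * 'Y; 'X ^+ 2 * 'Y ^+ 2] k.

Definition M0 (R : realType) (lam : R) : 'M[R]_9 :=
  moment_matrix lam (poly_P lam) (0, 0).
Definition Mg (R : realType) (lam : R) (w : R * R) : 'M[R]_9 :=
  moment_matrix lam (@poly_R R) w.
Definition N (R : realType) (lam : R) (w : R * R) : 'M[R]_9 :=
  moment_matrix lam (@poly_Q R) w.

(* Pairs (f, f^eq) on which a relaxation is defined: the fluid velocity of f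
   makes sense and the equilibrium has the same mass and momentum as f. *)
Definition admissible (R : realType) (lam : R) (f feq : 'cV[R]_9) : Prop :=
  [/\ density f != 0, density feq = density f
    & momentum lam feq = momentum lam f].

(* fstar is the post-collision distribution of the cascaded scheme. The two
   equations for g_3 and g_4 are the rows of the 2 x 2 system. *)
Definition cascaded_relaxation (R : realType) (lam s3 s4 s5 s6 s7 s8 : R)
    (f feq fstar : 'cV[R]_9) : Prop :=
  let u := fluid_velocity lam f in
  let C := Mg lam u *m (M0 lam)^T in
  let mg := Mg lam u *m f in
  let mgeq := Mg lam u *m feq in
  let delta k := (mgeq - mg) k 0 in
  exists2 g : 'cV[R]_9,
    [/\ [/\ g (ix 0) 0 = 0, g (ix 1) 0 = 0 & g (ix 2) 0 = 0],
        delta (ix 3) = C (ix 3) (ix 3) * (1 / s3 * g (ix 3) 0)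
                     + C (ix 3) (ix 4) * (1 / s4 * g (ix 4) 0),
        delta (ix 4) = C (ix 4) (ix 3) * (1 / s3 * g (ix 3) 0)
                     + C (ix 4) (ix 4) * (1 / s4 * g (ix 4) 0)
      & [/\ s5 * delta (ix 5)
              = \sum_(j < 9 | (1 <= j <= 5)%N) C (ix 5) j * g j 0,
            s6 * delta (ix 6)
              = \sum_(j < 9 | (1 <= j <= 6)%N) C (ix 6) j * g j 0,
            s7 * delta (ix 7)
              = \sum_(j < 9 | (1 <= j <= 7)%N) C (ix 7) j * g j 0
          & s8 * delta (ix 8)
              = \sum_(j < 9 | (1 <= j <= 8)%N) C (ix 8) j * g j 0]]
    & fstar = f + (M0 lam)^T *m g.

(* The relaxation [relax f feq fstar] is that of a scheme with relative
   velocities, for the polynomials P, the relaxation parameters s and the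
   velocity field util (a function of the distribution). Invertibility of
   M(util) is what makes f^star well defined by its moments, so that the
   equivalence also says that [relax] determines f^star uniquely. *)
Definition relative_velocity_scheme (R : realType) (lam : R)
    (P : 'I_9 -> {poly {poly R}}) (s : 'I_9 -> R) (util : 'cV[R]_9 -> R * R)
    (relax : 'cV[R]_9 -> 'cV[R]_9 -> 'cV[R]_9 -> Prop) : Prop :=
  forall f feq : 'cV[R]_9, admissible lam f feq ->
    let M := moment_matrix lam P (util f) in
    let m := M *m f in
    let meq := M *m feq in
    M \in unitmx /\
    forall fstar : 'cV[R]_9,
      relax f feq fstar <->
      (forall k, (M *m fstar) k 0 = m k 0 + s k * (meq k 0 - m k 0)).

(* Main.v *)
(* The P_j are orthogonal for the sum over the nine velocities, and the span of
   Q_0, ..., Q_k shifted by u is, as functions on the velocities, that of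
   P_0, ..., P_k. Hence T = N(u) M(0)^T is lower triangular with nonzero diagonal.
   Since Q_3 = R_3 + R_4 and Q_4 = R_3 - R_4, and T_43 = 0 as well, adding and
   subtracting the two equations for g_3 and g_4 decouples them, so that the
   cascaded equations for g say exactly T g = D (N(u) feq - N(u) f). *)
Require Import Defs.
From mathcomp Require Import all_boot all_order all_algebra.
From mathcomp Require Import reals.
From mathcomp Require Import ring lra.

Import Order.TTheory GRing.Theory Num.Theory.
Local Open Scope ring_scope.

(** * Values of the polynomials at points *)

Lemma horner2_poly_P (R : realType) (lam x y : R) (k : 'I_9) :
  (poly_P lam k).[x, y] = nth 0
    [:: 1; x; y;
        lam ^- 2 * (3 * (x ^+ 2 + y ^+ 2) - 4 * lam ^+ 2);
        lam ^- 2 * (x ^+ 2 - y ^+ 2);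
        lam ^- 2 * (x * y);
        lam ^- 3 * x * (3 * (x ^+ 2 + y ^+ 2) - 5 * lam ^+ 2);
        lam ^- 3 * y * (3 * (x ^+ 2 + y ^+ 2) - 5 * lam ^+ 2);
        lam ^- 4 * (9 / 2 * (x ^+ 2 + y ^+ 2) ^+ 2
          - 21 * lam ^+ 2 / 2 * (x ^+ 2 + y ^+ 2) + 4 * lam ^+ 4)] k.
Proof.
case: k => -[|[|[|[|[|[|[|[|[|//]]]]]]]]] lt_k;
  by rewrite /poly_P /= !hornerE /=; ring.
Qed.

Lemma horner2_poly_R (R : realType) (x y : R) (k : 'I_9) :
  (poly_R R k).[x, y] = nth 0
    [:: 1; x; y; x ^+ 2; y ^+ 2; x * y;
        x * y ^+ 2; x ^+ 2 * y; x ^+ 2 * y ^+ 2] k.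
Proof.
by case: k => -[|[|[|[|[|[|[|[|[|//]]]]]]]]] lt_k; rewrite /poly_R /= !hornerE.
Qed.

Lemma horner2_poly_Q (R : realType) (x y : R) (k : 'I_9) :
  (poly_Q R k).[x, y] = nth 0
    [:: 1; x; y; x ^+ 2 + y ^+ 2; x ^+ 2 - y ^+ 2; x * y;
        x * y ^+ 2; x ^+ 2 * y; x ^+ 2 * y ^+ 2] k.
Proof.
by case: k => -[|[|[|[|[|[|[|[|[|//]]]]]]]]] lt_k; rewrite /poly_Q /= !hornerE.
Qed.

(** The assumption is on the products, so that a term left of the diagonal may vanish through [x] or
    through [A]; row 4 below uses both. *)
Lemma mulmx_trig_row (R : pzRingType) (n : nat) (A : 'M[R]_n) (x : 'cV[R]_n)
    (k : 'I_n) :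
    is_trig_mx A -> (forall j : 'I_n, (j < k)%N -> A k j * x j 0 = 0) ->
  (A *m x) k 0 = A k k * x k 0.
Proof.
move=> /is_trig_mxP trigA low0; rewrite mxE (bigD1 k) //= big1 ?addr0 // => j.
rewrite -val_eqE neq_ltn => /orP[/low0 //|/trigA ->]; exact: mul0r.
Qed.

(** * Conserved moments and change of basis between [Mg] and [N] *)

Lemma N_conserved0 (R : realType) (lam : R) (w : R * R) (f : 'cV[R]_9) :
  (N lam w *m f) (ix 0) 0 = density f.
Proof.
by rewrite mxE; apply: eq_bigr => j _; rewrite mxE horner2_poly_Q mul1r.
Qed.

Lemma N_conserved1 (R : realType) (lam : R) (w : R * R) (f : 'cV[R]_9) :
  (N lam w *m f) (ix 1) 0 = (momentum lam f).1 - w.1 * density f.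
Proof.
rewrite mxE mulr_sumr -sumrB; apply: eq_bigr => j _.
by rewrite mxE horner2_poly_Q mulrBl.
Qed.

Lemma N_conserved2 (R : realType) (lam : R) (w : R * R) (f : 'cV[R]_9) :
  (N lam w *m f) (ix 2) 0 = (momentum lam f).2 - w.2 * density f.
Proof.
rewrite mxE mulr_sumr -sumrB; apply: eq_bigr => j _.
by rewrite mxE horner2_poly_Q mulrBl.
Qed.

Lemma ord9_lt3 (P : 'I_9 -> Prop) :
  P (ix 0) -> P (ix 1) -> P (ix 2) -> forall k : 'I_9, (k < 3)%N -> P k.
Proof.
by move=> P0 P1 P2 [[|[|[|//]]] lt_k] _; rewrite (bool_irrelevance lt_k isT).
Qed.

Lemma admissible_conserved (R : realType) (lam : R) (w : R * R)
    (f feq : 'cV[R]_9) (k : 'I_9) :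
  admissible lam f feq -> (k < 3)%N -> (N lam w *m (feq - f)) k 0 = 0.
Proof.
case=> _ rhoE qE; rewrite mulmxBr; move: k; apply: ord9_lt3.
- by rewrite mxE [X in _ + X]mxE !N_conserved0 rhoE subrr.
- by rewrite mxE [X in _ + X]mxE !N_conserved1 rhoE qE subrr.
- by rewrite mxE [X in _ + X]mxE !N_conserved2 rhoE qE subrr.
Qed.

(** This is $X^2 = (Q_3 + Q_4)/2$. The factor [B] is arbitrary so that the rule covers the matrix
    $C$ as well as the moment vectors. *)
Lemma Mg_mulmx3 (R : realType) (lam : R) (w : R * R) n (B : 'M[R]_(9, n)) j :
  (Mg lam w *m B) (ix 3) j =
    ((N lam w *m B) (ix 3) j + (N lam w *m B) (ix 4) j) / 2.
Proof.
rewrite !mxE -big_split mulr_suml; apply: eq_bigr => i _.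
by rewrite !mxE !(horner2_poly_Q, horner2_poly_R) /=; field.
Qed.

Lemma Mg_mulmx4 (R : realType) (lam : R) (w : R * R) n (B : 'M[R]_(9, n)) j :
  (Mg lam w *m B) (ix 4) j =
    ((N lam w *m B) (ix 3) j - (N lam w *m B) (ix 4) j) / 2.
Proof.
rewrite !mxE -sumrB mulr_suml; apply: eq_bigr => i _.
by rewrite !mxE !(horner2_poly_Q, horner2_poly_R) /=; field.
Qed.

Lemma Mg_mulmx_gt4 (R : realType) (lam : R) (w : R * R) n (B : 'M[R]_(9, n))
    (k : 'I_9) j :
  (4 < k)%N -> (Mg lam w *m B) k j = (N lam w *m B) k j.
Proof.
move=> lt4k; rewrite !mxE; apply: eq_bigr => i _.
rewrite !mxE horner2_poly_Q horner2_poly_R.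
by case: k lt4k => -[|[|[|[|[|k]]]]].
Qed.

(** * The triangular matrix $T = N(w)\,{}^tM(0)$ *)

Definition transfer_mx (R : realType) (lam : R) (w : R * R) : 'M[R]_9 :=
  N lam w *m (M0 lam)^T.

Lemma transfer_mxE (R : realType) (lam : R) (w : R * R) k j :
  transfer_mx R lam w k j =
  \sum_i (poly_Q R k).[(velocity lam i).1 - w.1, (velocity lam i).2 - w.2]
       * (poly_P lam j).[(velocity lam i).1, (velocity lam i).2].
Proof.
by rewrite mxE; apply: eq_bigr => i _; rewrite !mxE /= !subr0.
Qed.

(** On the nine velocities $X^3 = \lambda^2 X$ and $Y^3 = \lambda^2 Y$, so the shifted $Q_k$ is a
    combination of $P_0, \dots, P_k$, all orthogonal to $P_j$ for $j > k$. The proof checks the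
    finitely many entries. *)
Lemma transfer_mx_trig (R : realType) (lam : R) (w : R * R) :
  lam != 0 -> is_trig_mx (transfer_mx R lam w).
Proof.
move=> lam_neq0; apply/is_trig_mxP => k j lt_kj; rewrite transfer_mxE.
under eq_bigr => i _ do rewrite horner2_poly_Q horner2_poly_P.
rewrite !big_ord_recl big_ord0 /velocity /=.
case: k j lt_kj => -[|[|[|[|[|[|[|[|[|//]]]]]]]]] lt_k;
  case=> -[|[|[|[|[|[|[|[|[|//]]]]]]]]] lt_j //= _; by field.
Qed.

(** Shifting $X^2 - Y^2 = \lambda^2 P_4$ only adds terms in $1, X, Y$, hence no component along
    $P_3$. *)
Lemma transfer_mx43 (R : realType) (lam : R) (w : R * R) :
  lam != 0 -> transfer_mx R lam w (ix 4) (ix 3) = 0.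
Proof.
move=> lam_neq0; rewrite transfer_mxE.
under eq_bigr => i _ do rewrite horner2_poly_Q horner2_poly_P.
by rewrite !big_ord_recl big_ord0 /velocity /=; field.
Qed.

(** The shift changes $Q_k$ only by terms orthogonal to $P_k$, so these values do not depend on
    [w]. *)
Lemma transfer_mx_diag (R : realType) (lam : R) (w : R * R) k :
  lam != 0 -> transfer_mx R lam w k k =
  nth 0 [:: 9; 6 * lam ^+ 2; 6 * lam ^+ 2; 12 * lam ^+ 2; 4 * lam ^+ 2;
            4 * lam ^+ 2; 4 * lam ^+ 3; 4 * lam ^+ 3; 4 * lam ^+ 4] k.
Proof.
move=> lam_neq0; rewrite transfer_mxE.
under eq_bigr => i _ do rewrite horner2_poly_Q horner2_poly_P.
rewrite !big_ord_recl big_ord0 /velocity /=.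
by case: k => -[|[|[|[|[|[|[|[|[|//]]]]]]]]] lt_k /=; field.
Qed.

Lemma transfer_mx_diag_neq0 (R : realType) (lam : R) (w : R * R) k :
  lam != 0 -> transfer_mx R lam w k k != 0.
Proof.
move=> lam_neq0; rewrite transfer_mx_diag //.
by case: k => -[|[|[|[|[|[|[|[|[|//]]]]]]]]] lt_k;
  rewrite /= ?mulf_neq0 ?expf_neq0 ?pnatr_eq0.
Qed.

(** Invertibility of the product gives that of both square factors, [N lam w] and the transpose of
    [M0 lam]. *)
Lemma transfer_mx_unit (R : realType) (lam : R) (w : R * R) :
  lam != 0 -> transfer_mx R lam w \in unitmx.
Proof.
move=> lam_neq0; rewrite unitmxE unitfE det_trig ?transfer_mx_trig //.
by apply/prodf_neq0 => k _; apply: transfer_mx_diag_neq0.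
Qed.

(** * The cascaded equations as one triangular system *)

Definition relaxation_rates (R : realType) (s3 s4 s5 s6 s7 s8 : R) : 'rV[R]_9 :=
  \row_k nth 0 [:: 0; 0; 0; s3; s4; s5; s6; s7; s8] k.

Definition cascaded_system (R : realType) (C : 'M[R]_9)
    (s3 s4 s5 s6 s7 s8 : R) (delta : 'I_9 -> R) (g : 'cV[R]_9) : Prop :=
  [/\ [/\ g (ix 0) 0 = 0, g (ix 1) 0 = 0 & g (ix 2) 0 = 0],
      delta (ix 3) = C (ix 3) (ix 3) * (1 / s3 * g (ix 3) 0)
                   + C (ix 3) (ix 4) * (1 / s4 * g (ix 4) 0),
      delta (ix 4) = C (ix 4) (ix 3) * (1 / s3 * g (ix 3) 0)
                   + C (ix 4) (ix 4) * (1 / s4 * g (ix 4) 0)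
    & [/\ s5 * delta (ix 5)
            = \sum_(j < 9 | (1 <= j <= 5)%N) C (ix 5) j * g j 0,
          s6 * delta (ix 6)
            = \sum_(j < 9 | (1 <= j <= 6)%N) C (ix 6) j * g j 0,
          s7 * delta (ix 7)
            = \sum_(j < 9 | (1 <= j <= 7)%N) C (ix 7) j * g j 0
        & s8 * delta (ix 8)
            = \sum_(j < 9 | (1 <= j <= 8)%N) C (ix 8) j * g j 0]].

(** The truncated sum is a full row: column 0 is killed by $g_0 = 0$, columns beyond [k] by
    triangularity, and $R_k = Q_k$ for $k > 4$. *)
Lemma cascaded_row (R : realType) (lam : R) (w : R * R) (g : 'cV[R]_9)
    (k : 'I_9) :
    lam != 0 -> g (ix 0) 0 = 0 -> (4 < k)%N ->
  \sum_(j < 9 | (1 <= j <= k)%N) (Mg lam w *m (M0 lam)^T) k j * g j 0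
    = (transfer_mx R lam w *m g) k 0.
Proof.
move=> lam_neq0 g0 lt4k; rewrite [RHS]mxE big_mkcond; apply: eq_bigr => j _.
case: ifPn => [_|]; first by rewrite Mg_mulmx_gt4.
rewrite negb_and -leqNgt leqn0 -ltnNge => /orP[/eqP j0|lt_kj].
  by rewrite (_ : j = ix 0) ?g0 ?mulr0 //; apply: val_inj.
by move/is_trig_mxP: (transfer_mx_trig R lam w lam_neq0) => ->; rewrite ?mul0r.
Qed.

Lemma cascaded_systemE (R : realType) (lam s3 s4 s5 s6 s7 s8 : R) (w : R * R)
    (e g : 'cV[R]_9) :
    lam != 0 -> s3 != 0 -> s4 != 0 ->
    (forall k : 'I_9, (k < 3)%N -> (N lam w *m e) k 0 = 0) ->
  cascaded_system R (Mg lam w *m (M0 lam)^T) s3 s4 s5 s6 s7 s8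
    (fun k => (Mg lam w *m e) k 0) g <->
  transfer_mx R lam w *m g
    = diag_mx (relaxation_rates R s3 s4 s5 s6 s7 s8) *m (N lam w *m e).
Proof.
move=> lam0 s30 s40 e0; rewrite /cascaded_system !Mg_mulmx3 !Mg_mulmx4.
rewrite -/(transfer_mx R lam w) !Mg_mulmx_gt4 //.
set T := transfer_mx R lam w; set D := diag_mx _; set n := N lam w *m e.
have trigT : is_trig_mx T by apply: transfer_mx_trig.
have T34 : T (ix 3) (ix 4) = 0 by move/is_trig_mxP: trigT => ->.
have T43 : T (ix 4) (ix 3) = 0 by apply: transfer_mx43.
have TD k : T k k != 0 by apply: transfer_mx_diag_neq0.
have DE k : (D *m n) k 0 = nth 0 [:: 0; 0; 0; s3; s4; s5; s6; s7; s8] k * n k 0.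
  by rewrite mul_diag_mx !mxE.
have row3 : (forall j : 'I_9, (j < 3)%N -> g j 0 = 0) ->
    (T *m g) (ix 3) 0 = T (ix 3) (ix 3) * g (ix 3) 0.
  by move=> g0; apply: mulmx_trig_row => // j /g0->; rewrite mulr0.
have row4 : (forall j : 'I_9, (j < 3)%N -> g j 0 = 0) ->
    (T *m g) (ix 4) 0 = T (ix 4) (ix 4) * g (ix 4) 0.
  move=> g0; apply: mulmx_trig_row => // j.
  (* Left of the diagonal only column 3 could survive, and there $T_{43} = 0$. *)
  rewrite ltnS leq_eqVlt => /orP[/eqP j3|/g0->]; last by rewrite mulr0.
  by rewrite (_ : j = ix 3) ?T43 ?mul0r //; apply: val_inj.
(* Now $C_{33} = C_{43} = T_{33}/2$ and $C_{34} = -C_{44} = T_{44}/2$: the sum of the two equations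
   involves only $g_3$, their difference only $g_4$. *)
rewrite T34 T43; split.
  case=> -[g0 g1 g2] eq3 eq4 [].
  rewrite !(@cascaded_row R lam w g (Ordinal _)) // => eq5 eq6 eq7 eq8.
  have glow := ord9_lt3 (fun j => g j 0 = 0) g0 g1 g2.
  have n3 : n (ix 3) 0 = T (ix 3) (ix 3) * (1 / s3 * g (ix 3) 0) by lra.
  have n4 : n (ix 4) 0 = T (ix 4) (ix 4) * (1 / s4 * g (ix 4) 0) by lra.
  apply/colP => k; rewrite DE; have [lt_k3|le3k] := ltnP k 3.
    rewrite e0 // mulr0 mulmx_trig_row ?glow ?mulr0 // => j lt_jk.
    by rewrite glow ?mulr0 // (ltn_trans lt_jk).
  case: k le3k => -[//|[//|[//|[|[|[|[|[|[|//]]]]]]]]] lt_k _;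
    rewrite (bool_irrelevance lt_k isT) /= -?eq5 -?eq6 -?eq7 -?eq8 //.
    by rewrite row3 // n3; field.
  by rewrite row4 // n4; field.
move=> /colP eqT.
have eqk k :
    (T *m g) k 0 = nth 0 [:: 0; 0; 0; s3; s4; s5; s6; s7; s8] k * n k 0.
  by rewrite eqT DE.
(* Forward substitution by strong induction: once the earlier $g_i$ vanish, row $j$ reads $T_{jj}
   g_j = 0$. *)
have glow (j : 'I_9) : (j < 3)%N -> g j 0 = 0.
  have [m] := ubnP (j : nat); elim: m j => // m IH j lt_jm lt_j3.
  have := eqk j; rewrite e0 // mulr0 mulmx_trig_row // => [/eqP|i lt_ij].
    by rewrite mulf_eq0 (negbTE (TD j)) => /eqP.
  by rewrite (IH i (leq_trans lt_ij lt_jm)) ?mulr0 // (ltn_trans lt_ij).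
have := eqk (ix 3); rewrite row3 //= => eq3.
have := eqk (ix 4); rewrite row4 //= => eq4.
have n3 : n (ix 3) 0 = T (ix 3) (ix 3) * (1 / s3 * g (ix 3) 0).
  by rewrite mulrCA eq3; field.
have n4 : n (ix 4) 0 = T (ix 4) (ix 4) * (1 / s4 * g (ix 4) 0).
  by rewrite mulrCA eq4; field.
split; [by split; apply: glow|lra|lra|].
by split; rewrite (@cascaded_row R lam w g (Ordinal _)) ?glow // eqk.
Qed.

(** With $f^\star - f = {}^tM(0)\,g$ one has $T g = N(u)(f^\star - f)$, so the system for [g]
    becomes the relaxation of moments. *)
Lemma cascaded_relaxationE (R : realType) (lam s3 s4 s5 s6 s7 s8 : R)
    (f feq fstar : 'cV[R]_9) :
    lam != 0 -> s3 != 0 -> s4 != 0 -> admissible lam f feq ->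
  let u := fluid_velocity lam f in
  cascaded_relaxation lam s3 s4 s5 s6 s7 s8 f feq fstar <->
  N lam u *m fstar = N lam u *m f
    + diag_mx (relaxation_rates R s3 s4 s5 s6 s7 s8)
        *m (N lam u *m feq - N lam u *m f).
Proof.
move=> lam0 s30 s40 adm u; rewrite /cascaded_relaxation -/u -!mulmxBr.
have sysE g := @cascaded_systemE R lam s3 s4 s5 s6 s7 s8 u (feq - f) g lam0
  s30 s40 (fun k => admissible_conserved R lam u f feq k adm).
have := transfer_mx_unit R lam u lam0.
rewrite unitmx_mul => /andP[uN uM0].
split=> [[g /sysE eqg ->]|eqfstar]; first by rewrite mulmxDr mulmxA eqg.
(* The only [g] compatible with [fstar], available since $M(0)$ is invertible. *)
exists (invmx (M0 lam)^T *m (fstar - f)); last by rewrite mulKVmx ?subrKC.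
by apply/sysE; rewrite -mulmxA mulKVmx // mulmxBr eqfstar addrC addKr.
Qed.

Theorem mainTheorem2 (R : realType) (s3 s4 s5 s6 s7 s8 : R)
    (hs3 : s3 != 0) (hs4 : s4 != 0) (hs5 : s5 != 0)
    (hs6 : s6 != 0) (hs7 : s7 != 0) (hs8 : s8 != 0) :
  exists2 D : 'M[R]_9, is_diag_mx D &
    forall lam : R, 0 < lam ->
      (forall f feq fstar : 'cV[R]_9,
         admissible lam f feq ->
         cascaded_relaxation lam s3 s4 s5 s6 s7 s8 f feq fstar ->
         let u := fluid_velocity lam f in
         N lam u *m fstar
           = N lam u *m f + D *m (N lam u *m feq - N lam u *m f))
      /\ relative_velocity_scheme lam (@poly_Q R) (fun k => D k k)
           (fluid_velocity lam)
           (cascaded_relaxation lam s3 s4 s5 s6 s7 s8).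
Proof.
(* The rates of the three conserved moments are set to 0, a free choice because $m^{\rm eq} - m$
   vanishes there. *)
exists (diag_mx (relaxation_rates R s3 s4 s5 s6 s7 s8)).
  exact: diag_mx_is_diag.
move=> lam /lt0r_neq0 lam0; split=> [f feq fstar adm|f feq adm].
  by move/cascaded_relaxationE; apply.
set D := diag_mx _; set u := fluid_velocity lam f; rewrite -/(N lam u) /=.
have DE (x : 'cV[R]_9) k : (D *m x) k 0 = D k k * x k 0.
  by rewrite mul_diag_mx !mxE eqxx.
split.
  by have := transfer_mx_unit R lam u lam0; rewrite unitmx_mul => /andP[].
(* What remains is the same vector identity read componentwise. *)
move=> fstar; rewrite cascaded_relaxationE // -/u -/D.
split=> [-> k|eqm]; first by rewrite mxE DE !mxE.
by apply/colP => k; rewrite eqm [RHS]mxE DE !mxE.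
Qed.
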